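(* Let $\Sigma$ be a finite alphabet and let $L(\mathcal{A})\subseteq T_\Sigma^\omega$ be a regular tree language accepted by an unambiguous Büchi tree automaton $\mathcal{A}$. Then $L(\mathcal{A})$ is a Borel subset of $T_\Sigma^\omega$.
   Context: For a finite alphabet $\Sigma$, $T_\Sigma^\omega$ is the set of all functions $t:\{l,r\}^\star\to\Sigma$ (infinite binary trees labelled in $\Sigma$, with root the empty word $\lambda$), with the Cantor (product of discrete) topology. A path of $t$ is an infinite sequence $t(u_0)t(u_1)\cdots$ of labels along an infinite branch, where $u_0=\lambda$ and $u_{i+1}\in\{u_il,u_ir\}$ for all $i$. A (nondeterministic) Büchi tree automaton is a tuple $\mathcal{A}=(K,\Sigma,\Delta,q_0,F)$ with $K$ a finite set of states, $\Sigma$ a finite alphabet, $\Delta\subseteq K\times\Sigma\times K\times K$, $q_0\in K$ and $F\subseteq K$. A run of $\mathcal{A}$ on $t\in T_\Sigma^\omega$ is a tree $\rho\in T_K^\omega$ with $\rho(\lambda)=q_0$ and $(\rho(u),t(u),\rho(u\cdot l),\rho(u\cdot r))\in\Delta$ for all $u\in\{l,r\}^\star$. The run is accepting if on each path of $\rho$ some state of $F$ appears infinitely often. $L(\mathcal{A})$ is the set of trees $t\in T_\Sigma^\omega$ on which $\mathcal{A}$ has at least one accepting run. (A tree language accepted by a Büchi tree automaton is in particular regular, i.e. accepted by some Muller tree automaton, so ''regular'' imposes no additional condition.) $\mathcal{A}$ is unambiguous if each tree $t\in T_\Sigma^\omega$ admits at most one accepting run of $\mathcal{A}$. *)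

(* Defs.v *)
From HB Require Import structures.
From mathcomp Require Import all_boot all_order.
From mathcomp Require Import all_classical all_reals all_analysis.

Set Implicit Arguments.
Unset Strict Implicit.
Unset Printing Implicit Defensive.

Local Open Scope classical_set_scope.

(* Words over {l, r}, with l = false and r = true; the children of u are
   rcons u dl and rcons u dr. *)
Definition node := seq bool.

Notation dl := false (only parsing).
Notation dr := true (only parsing).

Definition tree (S : Type) := node -> S.

(* The Cantor topology; trees are plain functions, so it is copied from the
   library product of discrete spaces. *)
HB.instance Definition _ (S : choiceType) :=
  Topological.copy (tree S) {ptws node -> discrete_topology S}.

Definition borel (X : topologicalType) (B : set X) : Prop := <<s open >> B.

Definition branch (u : nat -> node) : Prop :=
  u 0 = [::] /\
  forall i, u i.+1 = rcons (u i) dl \/ u i.+1 = rcons (u i) dr.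

Definition path_of (S : Type) (t : tree S) (p : nat -> S) : Prop :=
  exists2 u, branch u & forall i, p i = t (u i).

Record buchi_automaton (Sigma : finType) := BuchiAutomaton {
  state : finType;
  transitions : {set state * Sigma * state * state};
  initial : state;
  final : {set state} }.

Section Language.
Variables (Sigma : finType) (A : buchi_automaton Sigma).

Definition run (t : tree Sigma) (rho : tree (state A)) : Prop :=
  rho [::] = initial A /\
  forall u, (rho u, t u, rho (rcons u dl), rho (rcons u dr)) \in transitions A.

Definition infinitely_often (T : Type) (p : nat -> T) (q : T) : Prop :=
  forall n, exists2 m, n <= m & p m = q.

Definition accepting_run (t : tree Sigma) (rho : tree (state A)) : Prop :=
  run t rho /\
  forall p, path_of rho p -> exists2 q, q \in final A & infinitely_often p q.

Definition language : set (tree Sigma) :=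
  [set t | exists rho, accepting_run t rho].

Definition unambiguous : Prop :=
  forall t rho rho', accepting_run t rho -> accepting_run t rho' -> rho = rho'.

End Language.

(* Main.v *)
From HB Require Import structures.
Require Import Defs.
From mathcomp Require Import all_boot.
From mathcomp Require Import all_classical all_analysis.

Set Implicit Arguments.
Unset Strict Implicit.
Unset Printing Implicit Defensive.

Local Open Scope classical_set_scope.

(* By Koenig's lemma a run is accepting iff every node u has a least k(u) such
   that all paths from u meet a final state within k(u) steps. The triples
   (t, rho, k), with rho a run on t and k this function, form a closed set of
   labelled trees; since k is determined by rho, and rho by t when the automaton
   is unambiguous, the projection to t is injective on it. Its image is the
   language, which is Borel by the Lusin-Souslin theorem. *)

(** * Borel sets and separation by Borel sets *)

Section BorelSets.
Variable X : topologicalType.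
Implicit Types A B : set X.

Lemma borel_open A : open A -> borel A.
Proof. exact: sub_gen_smallest. Qed.

Lemma borelC A : borel A -> borel (~` A).
Proof. by rewrite -setTD; exact: sigma_algebraCD. Qed.

Lemma borel_closed A : closed A -> borel A.
Proof. by move=> /closed_openC oA; rewrite -[A]setCK; apply: borelC; exact: borel_open. Qed.

Lemma borel0 : @borel X set0.
Proof. exact: borel_open open0. Qed.

Lemma borelT : @borel X setT.
Proof. exact: borel_open openT. Qed.

Lemma borel_bigcup (T : countType) (F : T -> set X) :
  (forall i, borel (F i)) -> borel (\bigcup_i F i).
Proof.
move=> bF; pose G n := if unpickle n is Some i then F i else set0.
have -> : \bigcup_i F i = \bigcup_n G n.
  apply/seteqP; split=> [y [i _ Fy]|y [n _]].
    by exists (pickle i) => //; rewrite /G pickleK.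
  by rewrite /G; case: unpickle => // i Fy; exists i.
apply: sigma_algebra_bigcup => n; rewrite /G.
by case: unpickle => [i|]; [exact: bF | exact: borel0].
Qed.

Lemma borel_bigcap (T : countType) (F : T -> set X) :
  (forall i, borel (F i)) -> borel (\bigcap_i F i).
Proof.
move=> bF; rewrite -[X in borel X]setCK setC_bigcap.
by apply: borelC; apply: borel_bigcup => i; exact: borelC.
Qed.

Lemma borelI A B : borel A -> borel B -> borel (A `&` B).
Proof.
move=> bA bB.
have -> : A `&` B = \bigcap_b (if b then A else B).
  apply/seteqP; split=> [y [Ay By] []//|y ABy].
  by split; [exact: (ABy true) | exact: (ABy false)].
by apply: borel_bigcap => -[].
Qed.

Lemma borelD A B : borel A -> borel B -> borel (A `\` B).
Proof. by move=> bA bB; rewrite setDE; apply: borelI => //; exact: borelC. Qed.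

Definition borel_separated A B :=
  exists D, [/\ borel D, A `<=` D & D `<=` ~` B].

(** Used in contrapositive form: two countable unions that cannot be separated contain two pieces
    that cannot be. *)
Lemma borel_separated_bigcup (T : countType) (F G : T -> set X) :
  (forall i j, borel_separated (F i) (G j)) ->
  borel_separated (\bigcup_i F i) (\bigcup_j G j).
Proof.
move=> sFG.
have [D Ds] := choice (fun ij : T * T => sFG ij.1 ij.2).
exists (\bigcup_i \bigcap_j D (i, j)); split.
- apply: borel_bigcup => i; apply: borel_bigcap => j.
  by have [] := Ds (i, j).
- move=> y [i _ Fy]; exists i => // j _.
  by have [_ + _] := Ds (i, j); exact.
- move=> y [i _ Dy] [j _ Gy].
  by have [_ _ /(_ y (Dy j I))] := Ds (i, j).
Qed.

End BorelSets.

(** * Infinite sequences and their finite prefixes *)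

Section Limits.
Variable C : Type.

Lemma rcons_chain_limit (s : nat -> seq C) :
  (forall k, exists c, s k.+1 = rcons (s k) c) ->
  exists x, forall k, mkseq x (size (s k)) = s k.
Proof.
move=> sS; have [c0 _] := sS 0.
have szS k : size (s k.+1) = (size (s k)).+1.
  by have [c ->] := sS k; rewrite size_rcons.
have lek k : k <= size (s k).
  by elim: k => // k IH; rewrite szS ltnS.
have nthS k l i : k <= l -> i < size (s k) -> nth c0 (s l) i = nth c0 (s k) i.
  move=> /subnKC <- ik; elim: (l - k) => [|j IH]; first by rewrite addn0.
  have [c e] := sS (k + j); rewrite addnS e nth_rcons.
  suff -> : i < size (s (k + j)) by [].
  apply: leq_trans ik _; elim: j {IH c e} => [|j IH]; first by rewrite addn0.
  by rewrite addnS szS; apply: leq_trans IH _.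
(* Lengths grow by one at each step, so [s i.+1] has an [i]-th letter and the default [c0] is never
   read. *)
exists (fun i => nth c0 (s i.+1) i) => k.
apply: (@eq_from_nth _ c0); first by rewrite size_mkseq.
move=> i; rewrite size_mkseq => ik; rewrite nth_mkseq //.
by case: (leqP k i.+1) => [ki|/ltnW ki]; [|symmetry]; apply: nthS.
Qed.

Lemma mkseq_le (x y : nat -> C) m n :
  m <= n -> mkseq x n = mkseq y n -> mkseq x m = mkseq y m.
Proof.
move=> mn; rewrite /mkseq => e.
rewrite -[m](minn_idPl mn) -take_iota !map_take.
by rewrite e.
Qed.

Lemma eq_mkseqP (x y : nat -> C) n :
  mkseq x n = mkseq y n <-> forall i, i < n -> x i = y i.
Proof.
split=> [e i ni|e].
  by rewrite -(nth_mkseq (x 0) x ni) e nth_mkseq.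
rewrite /mkseq; elim: n e => // n IH e.
rewrite -addn1 iotaD !map_cat IH /= ?e // => i ni.
by apply: e; apply: leq_trans ni _.
Qed.

End Limits.

(** * Injective continuous images of closed sets of sequences *)

(* C is discrete: closedness of S and continuity of f on S are stated through
   agreement on finite prefixes. *)
Section LusinSouslin.
Variables (C : countType) (X : topologicalType).
Variables (S : set (nat -> C)) (f : (nat -> C) -> X).
Hypothesis hX : hausdorff_space X.
Hypothesis closedS : forall x,
  (forall n, exists2 y, S y & mkseq y n = mkseq x n) -> S x.
Hypothesis contf : forall x, S x -> forall U, nbhs (f x) U ->
  exists n, forall y, S y -> mkseq y n = mkseq x n -> U (f y).
Hypothesis injf : forall x y, S x -> S y -> f x = f y -> x = y.

Let img (s : seq C) : set X :=
  [set f x | x in [set x | S x /\ mkseq x (size s) = s]].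

Let img_rcons s : img s = \bigcup_c img (rcons s c).
Proof.
apply/seteqP; split=> [_ [x [Sx xs] <-]|_ [c _ [x [Sx +] <-]]].
  exists (x (size s)) => //; exists x => //; split=> //.
  by rewrite size_rcons mkseqS xs.
rewrite size_rcons mkseqS => /rcons_inj [xs _].
by exists x.
Qed.

Let limit_mem x : (forall n, img (mkseq x n) !=set0) -> S x.
Proof.
move=> ne; apply: closedS => n; have [_ [y [Sy + _]]] := ne n.
by rewrite size_mkseq => yx; exists y.
Qed.

Let img_small x U : S x -> nbhs (f x) U -> exists n, img (mkseq x n) `<=` U.
Proof.
move=> Sx fU; have [n nU] := contf Sx fU; exists n => _ [y [Sy + <-]].
by rewrite size_mkseq; exact: nU.
Qed.

Let img_anti x m n : m <= n -> img (mkseq x n) `<=` img (mkseq x m).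
Proof.
move=> mn _ [y [Sy + <-]]; rewrite size_mkseq => /(mkseq_le mn) e.
by exists y => //; rewrite size_mkseq.
Qed.

Let hausdorff_disjoint (a b : X) : a <> b ->
  exists U V : set X, [/\ open U, open V, U a, V b & U `<=` ~` V].
Proof.
move=> /eqP ab; move: hX; rewrite open_hausdorff => /(_ _ _ ab).
move=> [[U V]] /= [] /set_mem Ua /set_mem Vb [oU oV /eqP UV].
by exists U, V; split=> //; apply/disjoints_subset.
Qed.

(* If the images were not separated, some one-letter extensions of s and s'
   would not be either; the limits x <> x' of such chains lie in S, and disjoint
   neighbourhoods of f x and f x' separate the images of long prefixes. *)
Let img_separated s s' : size s = size s' -> s <> s' ->
  borel_separated (img s) (img s').
Proof.
move=> ss' nss'; apply: contrapT => nsep.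
pose bad p := ~ borel_separated (img p.1) (img p.2).
(* The guard [bad p] makes the relation total, as [choice] demands. *)
have step (p : seq C * seq C) : exists q, bad p ->
    bad q /\ exists c d, q = (rcons p.1 c, rcons p.2 d).
  case: (pselect (bad p)) => [bp|]; last by exists p.
  suff [c [d cd]] : exists c d, bad (rcons p.1 c, rcons p.2 d).
    by exists (rcons p.1 c, rcons p.2 d) => _; split=> //; exists c, d.
  apply: contrapT => ncd; apply: bp; rewrite (img_rcons p.1) (img_rcons p.2).
  apply: borel_separated_bigcup => c d; apply: contrapT => bcd.
  by apply: ncd; exists c, d.
have [g gP] := choice step.
pose p k := iter k g (s, s').
have bp k : bad (p k) by elim: k => // k IH; have [] := gP _ IH.
have pS k : exists c d, p k.+1 = (rcons (p k).1 c, rcons (p k).2 d).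
  by have [] := gP _ (bp k).
have [|x xp] := @rcons_chain_limit C (fun k => (p k).1).
  by move=> k; have [c [d ->]] := pS k; exists c.
have [|x' xp'] := @rcons_chain_limit C (fun k => (p k).2).
  by move=> k; have [c [d ->]] := pS k; exists d.
have szp k : size (p k).1 = size s + k /\ size (p k).2 = size s + k.
  elim: k => [|k [IH1 IH2]]; first by rewrite addn0 /= ss'.
  by have [c [d ->]] := pS k; rewrite !size_rcons IH1 IH2 addnS.
(* The words of [p n] have length [size s + n], so the images of the prefixes of length [n] contain
   theirs and are no easier to separate. *)
have nsepn n : ~ borel_separated (img (mkseq x n)) (img (mkseq x' n)).
  move=> [D [bD xD Dx']]; apply: (bp n); exists D.
  have [e1 e2] := szp n; rewrite -xp -xp' e1 e2.
  split=> //; first by apply: subset_trans xD; exact/img_anti/leq_addl.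
  by apply: subset_trans Dx' _; apply/subsetC/img_anti/leq_addl.
(* An empty image would be separated by [set0], so every prefix of [x] has a nonempty image. *)
have Sx : S x.
  apply: limit_mem => n; apply/set0P/eqP => e; apply: (nsepn n).
  by exists set0; rewrite e; split=> //; exact: borel0.
have Sx' : S x'.
  apply: limit_mem => n; apply/set0P/eqP => e; apply: (nsepn n).
  by exists setT; rewrite e setC0; split=> //; exact: borelT.
have nfx : f x <> f x'.
  move=> /(injf Sx Sx') e; apply: nss'.
  by have := xp 0; have := xp' 0; rewrite /= e -ss' => -> ->.
have [U [V [oU oV Ux Vx' UV]]] := hausdorff_disjoint nfx.
have [n nU] := img_small Sx (open_nbhs_nbhs (conj oU Ux)).
have [m mV] := img_small Sx' (open_nbhs_nbhs (conj oV Vx')).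
apply: (nsepn (maxn n m)); exists U; split; first exact: borel_open.
  by apply: subset_trans nU; exact/img_anti/leq_maxl.
apply: (subset_trans UV); apply/subsetC/(subset_trans _ mV).
exact/img_anti/leq_maxr.
Qed.

(** Each [img s] is enlarged to a Borel set inside its closure, disjointly for words of equal
    length; the range becomes a countable intersection of countable unions of such sets. *)
Theorem lusin_souslin : borel (f @` S).
Proof.
pose comp (p : seq C * seq C) := size p.1 = size p.2 /\ p.1 <> p.2.
have [D DP] : {D : seq C * seq C -> set X & forall p, comp p ->
    [/\ borel (D p), img p.1 `<=` D p & D p `<=` ~` img p.2]}.
  apply: (@choice _ _ (fun p D => comp p ->
    [/\ borel D, img p.1 `<=` D & D `<=` ~` img p.2])) => p.
  case: (pselect (comp p)) => [[e n]|]; last by exists set0.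
  by have [D ?] := img_separated e n; exists D.
(* [D (s, s')] avoids [img s'] but may meet [D (s', s)]; removing the latter makes [E s s'] and
   [E s' s] disjoint. The value [setT] puts no condition on other pairs. *)
pose E s s' := if `[< comp (s, s') >] then D (s, s') `\` D (s', s) else setT.
have compC s s' : comp (s, s') -> comp (s', s).
  by move=> [e n]; split=> // /esym.
have bE s s' : borel (E s s').
  rewrite /E; case: asboolP => [c|_]; last exact: borelT.
  have [? _ _] := DP _ c; have [? _ _] := DP _ (compC _ _ c).
  exact: borelD.
have imgE s s' : img s `<=` E s s'.
  move=> y ys; rewrite /E; case: asboolP => // c.
  have [_ + _] := DP _ c; have [_ _ +] := DP _ (compC _ _ c).
  by move=> h1 h2; split; [exact: h2 | move/h1; exact].
(* For each length the sets B s are pairwise disjoint, so a point lying in one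
   of them at every length picks out a single sequence x; the closure forces
   its value to be f x. *)
pose B s := closure (img s) `&` \bigcap_s' E s s'.
have bB s : borel (B s).
  apply: borelI; first by apply: borel_closed; exact: closed_closure.
  exact: borel_bigcap.
have Binj s s' y : size s = size s' -> B s y -> B s' y -> s = s'.
  move=> e [_ /(_ s' I)] + [_ /(_ s I)]; rewrite /E.
  case: asboolP => [c|c _ _].
    by case: asboolP => [_ [_ +] []|/(_ (compC _ _ c))].
  by apply: contrapT => n; apply: c.
(* Membership at all prefixes forces the words chosen at successive lengths to extend one
   another. *)
pose B' s := \bigcap_k B (take k s).
have bB' s : borel (B' s) by apply: borel_bigcap.
have -> : f @` S = \bigcap_n \bigcup_s (if size s == n then B' s else set0).
  apply/seteqP; split=> [_ [x Sx <-] n _|y yB].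
    exists (mkseq x n) => //; rewrite size_mkseq eqxx => k _.
    suff xk : img (take k (mkseq x n)) (f x).
      by split; [exact: subset_closure | move=> s' _; exact: imgE].
    exists x => //; split=> //.
    by rewrite size_take_min size_mkseq /mkseq -map_take take_iota.
  have [s sP] : {s : nat -> seq C & forall n, size (s n) = n /\ B' (s n) y}.
    apply: (@choice _ _ (fun n s => size s = n /\ B' s y)) => n.
    have [s _] := yB n I.
    by case: eqP => // <- ?; exists s.
  have sS n : exists c, s n.+1 = rcons (s n) c.
    have [szn Bn] := sP n; have [szS BS] := sP n.+1.
    have <- : take n (s n.+1) = s n.
      apply: (@Binj _ _ y); last 1 first.
      - by have := Bn n I; rewrite take_oversize ?szn.
      - by rewrite size_take szS ltnSn szn.
      - exact: BS.
    case: (s n.+1) szS => // c t szS.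
    exists (nth c (c :: t) n).
    by rewrite -take_nth ?szS // take_oversize ?szS.
  have [x xs] := rcons_chain_limit sS.
  have cl n : closure (img (mkseq x n)) y.
    have [szn Bn] := sP n.
    by have := xs n; rewrite szn => ->; have [] := Bn n I; rewrite take_oversize ?szn.
  have Sx : S x.
    by apply: limit_mem => n; have [z [? _]] := cl n setT filterT; exists z.
  exists x => //; apply: contrapT => nxy.
  have [U [V [oU oV Ux Vy UV]]] := hausdorff_disjoint nxy.
  have [n nU] := img_small Sx (open_nbhs_nbhs (conj oU Ux)).
  by have [z [/nU /UV]] := cl n V (open_nbhs_nbhs (conj oV Vy)).
apply: borel_bigcap => n; apply: borel_bigcup => s.
by case: eqP => _; [exact: bB' | exact: borel0].
Qed.

End LusinSouslin.

(** * The product topology on trees *)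

(** The product topology is a supremum of initial topologies, so the filter generated by the sets
    [V n] converges to [t] once it does so in each coordinate; [V (pickle u).+1] fixes the
    coordinate at [u]. *)
Lemma tree_nbhs (S : choiceType) (t : tree S) (U : set (tree S)) : nbhs t U ->
  exists n, forall t', (forall u, pickle u < n -> t' u = t u) -> U t'.
Proof.
pose V n := [set t' : tree S | forall u, pickle u < n -> t' u = t u].
have FV : Filter (filter_from setT V).
  apply: filter_from_filter; first by exists 0.
  move=> m n _ _; exists (maxn m n) => // t' Vt'.
  by split=> u un; apply: Vt'; rewrite leq_max un ?orbT.
suff Vt : filter_from setT V --> t.
  by move=> /Vt [n _ nU]; exists n => t' /nU.
apply/cvg_sup => u W [Z] [[Y] oY <-] Yt YW.
exists (pickle u).+1 => // t' /(_ u (ltnSn _)) e.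
by apply: YW; rewrite /preimage /= e.
Qed.

Lemma tree_hausdorff (S : choiceType) : hausdorff_space (tree S).
Proof.
apply: (@hausdorff_product _ (fun=> discrete_topology S)) => _.
exact: discrete_hausdorff.
Qed.

(** * Bars in binary trees and Koenig's lemma *)

Section Bar.
Variables (K : eqType) (P : pred K).

Fixpoint bar (rho : tree K) (m : nat) (u : node) : bool :=
  P (rho u) ||
  if m is m'.+1 then bar rho m' (rcons u dl) && bar rho m' (rcons u dr)
  else false.

Lemma bar_leq rho m n u : m <= n -> bar rho m u -> bar rho n u.
Proof.
elim: n m u => [|n IH] [|m] u //=.
  by rewrite orbF => _ ->.
rewrite ltnS => mn; case: (P _) => //= /andP [l r].
by rewrite !(IH m).
Qed.

(** Only the finitely many nodes at most [m] levels below [u] matter. This makes conditions on bars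
    closed. *)
Lemma bar_local rho m u : exists N, forall rho',
  (forall v, pickle v < N -> rho' v = rho v) -> bar rho' m u = bar rho m u.
Proof.
elim: m u => [|m IH] u; first by exists (pickle u).+1 => rho' /= ->.
have [[Nl Hl] [Nr Hr]] := (IH (rcons u dl), IH (rcons u dr)).
exists (maxn (pickle u).+1 (maxn Nl Nr)) => rho' e /=.
rewrite e ?leq_max ?leqnn // Hl ?Hr // => v vN;
by apply: e; rewrite !leq_max vN ?orbT.
Qed.

Lemma bar_branch rho b m n : branch b -> bar rho m (b n) ->
  exists2 i, n <= i & P (rho (b i)).
Proof.
move=> [_ bS]; elim: m n => [|m IH] n /=.
  by rewrite orbF => Pn; exists n.
case: (boolP (P _)) => [Pn _|_ /= /andP [l r]]; first by exists n.
have [i ni Pi] : exists2 i, n.+1 <= i & P (rho (b i)).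
  by apply: IH; case: (bS n) => ->.
by exists i => //; exact: ltnW.
Qed.

(* Otherwise a child of u is not barred either, and so on: there is a branch
   through u that avoids P from u on. *)
Lemma bar_exists rho u :
  (forall b, branch b -> forall n, exists2 i, n <= i & P (rho (b i))) ->
  exists m, bar rho m u.
Proof.
move=> Pb; apply: contrapT => nu.
pose Q v := exists w, u = v ++ w \/ v = u ++ w /\ ~ exists m, bar rho m v.
have Qstep v : exists c, Q v -> Q (rcons v c).
  case: (pselect (Q v)) => [[w Qw]|]; last by exists dl.
  (* The case [v = u] joins the second alternative, so in the first one [u] dictates the next
     letter. *)
  have {Qw w} [uv|[v' nv]] : (exists c w, u = rcons v c ++ w) \/
      (exists w, v = u ++ w) /\ ~ exists m, bar rho m v.
    case: Qw => [|[-> nv]]; last by right; split=> //; exists w.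
    case: w => [|c w0] e.
      have uv : u = v by rewrite e cats0.
      by right; split; [exists [::]; rewrite uv cats0 | rewrite -uv].
    by left; exists c, w0; rewrite cat_rcons.
  - by have [c [w uvw]] := uv; exists c => _; exists w; left.
  - have [w vw] := v'.
    have [c nc] : exists c, ~ exists m, bar rho m (rcons v c).
      apply: contrapT => nc; apply: nv.
      have all_c c : exists m, bar rho m (rcons v c).
        by apply: contrapT => ?; apply: nc; exists c.
      have [[m ml] [n nr]] := (all_c dl, all_c dr).
      exists (maxn m n).+1 => /=; apply/orP; right; apply/andP; split.
        exact: bar_leq (leq_maxl _ _) ml.
      exact: bar_leq (leq_maxr _ _) nr.
    by exists c => _; exists (rcons w c); right; rewrite -rcons_cat -vw.
have [g gP] := choice Qstep.
pose b n := iter n (fun v => rcons v (g v)) [::].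
have bQ n : Q (b n).
  by elim: n => [|n IH]; [exists u; left | exact: gP].
have szb n : size (b n) = n by elim: n => //= n IH; rewrite size_rcons IH.
have bb : branch b by split=> // n /=; case: (g _); [right | left].
(* A node in [P] is barred with height 0, so [b i] must be a prefix of [u]; its length then makes it
   [u] itself. *)
have [i ui Pi] := Pb b bb (size u).
have [w [e|[_]]] := bQ i; last by apply; exists 0; rewrite /= Pi.
have w0 : w = [::].
  apply/nilP; rewrite /nilp -leqn0 -(leq_add2l i) addn0.
  by rewrite -{1}(szb i) -size_cat -e.
by apply: nu; exists 0; rewrite /= e w0 cats0 Pi.
Qed.

(** Stating minimality as an equivalence for every [m] splits it into conditions that each involve
    finitely many labels. *)
Definition bar_height (rho : tree K) (k : tree nat) :=
  forall u m, bar rho m u = (k u <= m).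

Lemma bar_height_exists rho :
  (forall b, branch b -> forall n, exists2 i, n <= i & P (rho (b i))) ->
  exists k, bar_height rho k.
Proof.
move=> Pb; have ex u := bar_exists u Pb.
exists (fun u => ex_minn (ex u)) => u m.
case: ex_minnP => k barP kmin; apply/idP/idP => [/kmin//|km].
exact: bar_leq km barP.
Qed.

Lemma bar_height_uniq rho k k' :
  bar_height rho k -> bar_height rho k' -> k = k'.
Proof.
move=> hk hk'; apply/funext => u.
by apply/eqP; rewrite eqn_leq -hk hk' leqnn -hk' hk leqnn.
Qed.

End Bar.

(** * Accepting runs coded as sequences *)

Section Automaton.
Variables (Sigma : finType) (A : buchi_automaton Sigma).

Let final_pred : pred (state A) := fun q => q \in final A.

(** Pigeonhole: if each final state had a last visit on a branch, the maximum over the finitely many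
    states would bound all visits to [final A]. *)
Lemma accepting_branchP t (rho : tree (state A)) : accepting_run t rho <->
  run t rho /\
  forall b, branch b -> forall n, exists2 i, n <= i & final_pred (rho (b i)).
Proof.
split=> -[runt H]; split=> //.
  move=> b bb n; have [|q qF qio] := H (rho \o b); first by exists b.
  by have [i ni e] := qio n; exists i => //; rewrite /final_pred -e in qF *.
move=> p [b bb pb]; apply: contrapT => nq.
have bounded q : exists n, q \in final A -> forall i, n <= i -> p i <> q.
  apply: contrapT => nb; apply: nq; exists q.
    by apply: contrapT => qF; apply: nb; exists 0.
  move=> n; apply: contrapT => ni; apply: nb; exists n => _ i le_ni piq.
  by apply: ni; exists i.
have [N NP] := choice bounded.
have [i Ni Fi] := H b bb (\max_q N q).
apply: (NP (rho (b i)) Fi i); last exact: pb.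
by apply: leq_trans Ni; exact: leq_bigmax.
Qed.

Definition label : Type := Sigma * state A * nat.
HB.instance Definition _ := Countable.on label.

(** Numbers that [unpickle] rejects are sent to the root, so [enc] repeats the root label there. *)
Definition node_at (n : nat) : node := odflt [::] (unpickle n).

Lemma node_at_pickle u : node_at (pickle u) = u.
Proof. by rewrite /node_at pickleK. Qed.

Definition enc (x : tree label) : nat -> label := fun n => x (node_at n).
Definition dec (x : nat -> label) : tree label := fun u => x (pickle u).
Definition input (x : nat -> label) : tree Sigma := fun u => (dec x u).1.1.
Definition states (x : nat -> label) : tree (state A) := fun u => (dec x u).1.2.
Definition height (x : nat -> label) : tree nat := fun u => (dec x u).2.

(* The first clause makes the letters of x at indices that are not codes of
   nodes redundant. *)
Definition certificate : set (nat -> label) := [set x |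
  [/\ enc (dec x) = x, run (input x) (states x) &
      bar_height final_pred (states x) (height x)]].

Lemma certificate_accepting x :
  certificate x -> accepting_run (input x) (states x).
Proof.
move=> [_ runx hx]; apply/accepting_branchP; split=> // b bb n.
by apply: (@bar_branch _ _ _ _ (height x (b n))) => //; rewrite hx.
Qed.

Lemma accepting_certificate t (rho : tree (state A)) : accepting_run t rho ->
  exists2 x, certificate x & input x = t.
Proof.
move=> /accepting_branchP [runt /bar_height_exists [k hk]].
pose y : tree label := fun u => (t u, rho u, k u).
have decy : dec (enc y) = y by apply/funext => u; rewrite /dec /enc node_at_pickle.
have [et er ek] : [/\ input (enc y) = t, states (enc y) = rho & height (enc y) = k].
  by rewrite /input /states /height decy.
by exists (enc y) => //; split; rewrite ?decy // ?et er // ek.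
Qed.

Lemma language_certificate : language A = input @` certificate.
Proof.
apply/seteqP; split=> [t [rho /accepting_certificate [x cx <-]]|_ [x cx <-]].
  by exists x.
by exists (states x); exact: certificate_accepting.
Qed.

Lemma certificate_inj : unambiguous A ->
  forall x y, certificate x -> certificate y -> input x = input y -> x = y.
Proof.
move=> unamb x y cx cy e.
have [[ex _ hx] [ey _ hy]] := (cx, cy).
have er : states x = states y.
  apply: (unamb (input x)); first exact: certificate_accepting.
  by rewrite e; exact: certificate_accepting.
have ek : height x = height y.
  by rewrite er in hx; exact: bar_height_uniq hx hy.
suff exy : dec x = dec y by rewrite -ex -ey exy.
apply/funext => u; apply: injective_projections; last by have := congr1 (@^~ u) ek.
apply: injective_projections; first by have := congr1 (@^~ u) e.
by have := congr1 (@^~ u) er.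
Qed.

(** Every instance of a clause reads finitely many letters, so it is inherited from a member that
    agrees with [x] on a long enough prefix. *)
Lemma certificate_closed x :
  (forall n, exists2 y, certificate y & mkseq y n = mkseq x n) ->
  certificate x.
Proof.
move=> approx.
have near n : exists2 y, certificate y & forall u, pickle u < n -> dec y u = dec x u.
  have [y cy /eq_mkseqP yx] := approx n.
  by exists y => // u un; exact: yx.
split.
- apply/funext => n.
  (* The clause compares the letters at [n] and at [pickle (node_at n)], which may differ; the
     prefix must cover both. *)
  have [y [ey _ _] /eq_mkseqP yx] := approx (maxn n (pickle (node_at n))).+1.
  rewrite -(yx n) ?ltnS ?leq_maxl // -[in RHS]ey /enc /dec.
  by rewrite -yx // ltnS leq_maxr.
- split=> [|u].
    have [y [_ [y0 _] _] yx] := near (pickle ([::] : node)).+1.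
    by rewrite /states -yx.
  have [y [_ [_ yD] _] yx] := near (maxn (pickle u)
    (maxn (pickle (rcons u dl)) (pickle (rcons u dr)))).+1.
  by have := yD u; rewrite /states /input !yx // ltnS !leq_max leqnn ?orbT.
- move=> u m; have [N barN] := bar_local final_pred (states x) m u.
  have [y [_ _ hy] yx] := near (maxn N (pickle u).+1).
  rewrite -(barN (states y)) => [|v vN]; last first.
    by rewrite /states yx // leq_max vN.
  by rewrite hy /height yx // leq_max leqnn orbT.
Qed.

End Automaton.

Theorem corollary4p14 (Sigma : finType) (A : buchi_automaton Sigma) :
  unambiguous A -> borel (language A).
Proof.
move=> unamb; rewrite language_certificate.
apply: lusin_souslin.
- exact: tree_hausdorff.
- exact: certificate_closed.
- move=> x _ U /tree_nbhs [n nU]; exists n => y _ /eq_mkseqP yx.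
  by apply: nU => u un; rewrite /input /dec yx.
- exact: certificate_inj.
Qed.
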